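(* Let $\mathcal{Y}=\{1,\dots,k\}$ be a finite label set, $L\in\mathbb{R}^{k\times k}$ a task loss matrix with nonnegative entries, $\Phi:\mathbb{R}^k\times\mathcal{Y}\to\mathbb{R}$ a surrogate loss that is continuous and bounded from below, and $\mathcal{F}\subseteq\mathbb{R}^k$ a subspace of allowed score vectors. Let $H_{\Phi,L,\mathcal{F}}$ be the calibration function and let $\check H_{\Phi,L,\mathcal{F}}:[0,+\infty)\to[0,+\infty]$ be a convex non-decreasing function with $\check H_{\Phi,L,\mathcal{F}}(\varepsilon)\le H_{\Phi,L,\mathcal{F}}(\varepsilon)$ for all $\varepsilon\ge 0$. Then for any $\varepsilon>0$ such that $\check H_{\Phi,L,\mathcal{F}}(\varepsilon)$ is finite and any score function $f\in\mathcal{F}_{\mathcal{F}}$, $$\mathcal{R}_\Phi(f)<\mathcal{R}^*_{\Phi,\mathcal{F}}+\check H_{\Phi,L,\mathcal{F}}(\varepsilon)\ \Longrightarrow\ \mathcal{R}_L(f)<\mathcal{R}^*_{L,\mathcal{F}}+\varepsilon,$$ where $\mathcal{R}^*_{\Phi,\mathcal{F}}=\inf_{g\in\mathcal{F}_{\mathcal{F}}}\mathcal{R}_\Phi(g)$ and $\mathcal{R}^*_{L,\mathcal{F}}=\inf_{g\in\mathcal{F}_{\mathcal{F}}}\mathcal{R}_L(g)$.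
   Context: Predictor: for $f\in\mathbb{R}^k$, $\mathrm{pred}(f)$ is the smallest index $c$ among those maximizing $f_c$. For $q$ in the probability simplex $\Delta_k$, the conditional risk is $\ell(f,q)=\sum_{c=1}^k q_c L(\mathrm{pred}(f),c)$ and the conditional surrogate risk is $\phi(f,q)=\sum_{c=1}^k q_c\Phi(f,c)$; their excesses are $\delta\ell(f,q)=\ell(f,q)-\inf_{\hat f\in\mathcal{F}}\ell(\hat f,q)$ and $\delta\phi(f,q)=\phi(f,q)-\inf_{\hat f\in\mathcal{F}}\phi(\hat f,q)$. The calibration function is, for $\varepsilon\ge0$, $H_{\Phi,L,\mathcal{F}}(\varepsilon)=\inf\{\delta\phi(f,q): f\in\mathcal{F}, q\in\Delta_k, \delta\ell(f,q)\ge\varepsilon\}$, set to $+\infty$ if the feasible set is empty. Data: $(x,y)$ are drawn from a distribution $\mathcal{D}$ on $\mathcal{X}\times\mathcal{Y}$; $\mathcal{F}_{\mathcal{F}}$ is the set of all Borel measurable functions $f:\mathcal{X}\to\mathcal{F}$; $\mathcal{R}_L(f)=\mathbb{E}_{(x,y)\sim\mathcal{D}}L(\mathrm{pred}(f(x)),y)$ and $\mathcal{R}_\Phi(f)=\mathbb{E}_{(x,y)\sim\mathcal{D}}\Phi(f(x),y)$. *)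

(* Defs.v *)
From HB Require Import structures.
From mathcomp Require Import all_boot all_order all_algebra.
From mathcomp Require Import all_classical all_reals all_analysis.
Set Implicit Arguments. Unset Strict Implicit. Unset Printing Implicit Defensive.
Import Order.TTheory GRing.Theory Num.Theory.
Local Open Scope classical_set_scope.
Local Open Scope ring_scope.

(* The label set Y = {1,...,k}, with k = n.+1 >= 1, is 'I_n.+1, equipped
   with the discrete sigma-algebra. *)
Definition label (n : nat) : Type := 'I_n.+1.
HB.instance Definition _ n := Finite.on (label n).
HB.instance Definition _ n := isPointed.Build (label n) ord0.
HB.instance Definition _ n := @isMeasurable.Build default_measure_display
  (label n) discrete_measurable discrete_measurable0
  discrete_measurableC discrete_measurableU.

Section defs.
Variables (R : realType) (n : nat).
Local Notation vec := 'rV[R]_n.+1.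

Definition pred_score (f : vec) : label n :=
  odflt ord0 [pick c : 'I_n.+1 | [forall c' : 'I_n.+1, f 0 c' <= f 0 c] &&
                                [forall c' : 'I_n.+1, (f 0 c' == f 0 c) ==> (c <= c')%N]].

Definition simplex : set vec :=
  [set q | (forall c, 0 <= q 0 c) /\ \sum_(c < n.+1) q 0 c = 1].

Definition cond_risk (L : 'M[R]_n.+1) (f q : vec) : R :=
  \sum_(c < n.+1) q 0 c * L (pred_score f) c.
Definition cond_srisk (Phi : vec -> label n -> R) (f q : vec) : R :=
  \sum_(c < n.+1) q 0 c * Phi f c.

Definition excess_cond_risk (L : 'M[R]_n.+1) (F : set vec) (f q : vec)
  : \bar R :=
  ((cond_risk L f q)%:E - ereal_inf [set (cond_risk L g q)%:E | g in F])%E.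
Definition excess_cond_srisk (Phi : vec -> label n -> R) (F : set vec)
  (f q : vec) : \bar R :=
  ((cond_srisk Phi f q)%:E - ereal_inf [set (cond_srisk Phi g q)%:E | g in F])%E.

(* calibration function H_{Phi,L,F}(eps); ereal_inf set0 = +oo *)
Definition calibration (Phi : vec -> label n -> R) (L : 'M[R]_n.+1)
  (F : set vec) (eps : R) : \bar R :=
  ereal_inf [set e | exists f q, [/\ F f, simplex q,
     (eps%:E <= excess_cond_risk L F f q)%E & e = excess_cond_srisk Phi F f q]].

End defs.

Section risks.
Context {d : measure_display} {X : measurableType d} {R : realType} {n : nat}.
Local Notation vec := 'rV[R]_n.+1.

(* the set F_F of Borel measurable score functions X -> F; R^k carries the
   Borel (= product) sigma-algebra, via the library's tuple structure. *)
Definition score_funs (F : set vec) : set (X -> vec) :=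
  [set f | (forall x, F (f x)) /\
     measurable_fun [set: X] (fun x => [tuple f x 0 i | i < n.+1])].

Definition task_risk (D : probability (X * label n)%type R) (L : 'M[R]_n.+1)
  (f : X -> vec) : \bar R :=
  (\int[D]_z (L (pred_score (f z.1)) z.2)%:E)%E.
Definition surrogate_risk (D : probability (X * label n)%type R)
  (Phi : vec -> label n -> R) (f : X -> vec) : \bar R :=
  (\int[D]_z (Phi (f z.1) z.2)%:E)%E.
End risks.

(* Main.v *)
(* With q(x) the conditional law of the label given x, both risks are integrals
   over x of the conditional risks at (f(x), q(x)), and H (Hc below) minorizes the
   pointwise excess surrogate risk as a function of the pointwise excess task risk.
   Measurable h and g (an exact minimizer of the conditional task risk and a
   near-minimizer of the conditional surrogate risk, both selected from countable
   subsets of F) turn the infima of the risks into integrals.  If the excess task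
   risk of f were at least eps, then Jensen's inequality for H would force the
   excess surrogate risk of f to be at least H(eps). *)
Require Import Defs.
From HB Require Import structures.
From mathcomp Require Import all_boot all_order all_algebra.
From mathcomp Require Import all_classical all_reals all_analysis.
From mathcomp Require Import measurable_realfun.
From mathcomp Require Import ring lra.
Set Implicit Arguments. Unset Strict Implicit. Unset Printing Implicit Defensive.
Import Order.TTheory GRing.Theory Num.Theory numFieldTopology.Exports.
Local Open Scope classical_set_scope.
Local Open Scope ring_scope.

(** * Disintegration of [D] into its marginal on [X] and conditional label probabilities *)

Section conditional_law.
Local Open Scope ereal_scope.
Context (d : measure_display) (X : measurableType d) (R : realType) (n : nat).
Variable D : probability (X * label n)%type R.

Definition label_slice (c : label n) : set (X * label n) :=
  [set z | z.2 = c].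

Lemma measurable_label_slice c : measurable (label_slice c).
Proof.
rewrite -[label_slice c]setTI.
exact: (@measurable_snd _ _ X (label n) measurableT [set c]).
Qed.

(** The label takes finitely many values, so a preimage under [h] is a finite union of pieces, one
    in each label slice. *)
Lemma measurable_fun_label (dT : measure_display) (T : measurableType dT)
    (h : X * label n -> T) :
  (forall c, measurable_fun [set: X] (fun x => h (x, c))) ->
  measurable_fun setT h.
Proof.
move=> mh _ B mB; rewrite setTI.
have -> : h @^-1` B = \bigcup_(c in [set: label n])
    (label_slice c `&` fst @^-1` ((fun x => h (x, c)) @^-1` B)).
  apply/seteqP; split => [[x c] /= hB|[x c] /= [i _ [/= ci]]].
    by exists c.
  by rewrite /label_slice /= in ci *; rewrite ci.
apply: fin_bigcup_measurable => [|c _]; first exact: finite_finset.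
apply: measurableI; first exact: measurable_label_slice.
rewrite -[X in measurable X]setTI; apply: measurable_fst => //.
by rewrite -[X in measurable X]setTI; exact: mh.
Qed.

HB.instance Definition _ := isMeasurableFun.Build _ _ _ _ _
  (@measurable_fst _ _ X (label n)).

(** The unnormalized law of [x] on the event that the label is [c]; its density with respect to the
    marginal of [D] is the conditional probability of [c] given [x]. *)
Definition label_law (c : label n) : set X -> \bar R :=
  pushforward (mrestr D (measurable_label_slice c)) fst.

Let label_law0 c : label_law c set0 = 0. Proof. exact: measure0. Qed.

Let label_law_ge0 c A : 0 <= label_law c A.
Proof. exact: measure_ge0. Qed.

Let label_law_sigma_additive c : semi_sigma_additive (label_law c).
Proof. by apply: measure_semi_sigma_additive => //; exact: measurable_fst. Qed.

HB.instance Definition _ c := isMeasure.Build _ _ _ (label_law c)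
  (label_law0 c) (label_law_ge0 c) (@label_law_sigma_additive c).

Lemma label_lawE c A : label_law c A = D (fst @^-1` A `&` label_slice c).
Proof. by []. Qed.

Let measurable_preimage_fst (A : set X) : measurable A ->
  measurable (fst @^-1` A : set (X * label n)).
Proof. by rewrite -[fst @^-1` A]setTI; exact: measurable_fst. Qed.

Lemma label_law_le c A : measurable A -> label_law c A <= distribution D fst A.
Proof.
move=> mA; apply: le_measure; rewrite ?inE//.
- by apply: measurableI; [exact: measurable_preimage_fst|exact: measurable_label_slice].
- exact: measurable_preimage_fst.
Qed.

Let label_law_fin c : fin_num_fun (label_law c).
Proof.
move=> A mA; rewrite ge0_fin_numE// (le_lt_trans (label_law_le c mA))//.
by rewrite (le_lt_trans (probability_le1 _ mA))// ltry.
Qed.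

HB.instance Definition _ c := Measure_isFinite.Build _ _ _ (label_law c)
  (@label_law_fin c).

Lemma label_law_dominated c : label_law c `<< distribution D fst.
Proof.
apply/null_content_dominatesP => A mA A0; apply/eqP.
by rewrite -measure_le0 -A0; exact: label_law_le.
Qed.

Lemma sum_label_law A : measurable A ->
  \sum_(c < n.+1) label_law c A = distribution D fst A.
Proof.
move=> mA.
rewrite /distribution/= /pushforward.
have -> : fst @^-1` A = \bigcup_(c in [set` index_enum (label n)])
    (fst @^-1` A `&` label_slice c) :> set (X * label n).
  apply/seteqP; split => [[x c] /= Ax|[x c] /= [i _ [/= ]]//].
  by exists c => //=; rewrite mem_index_enum.
rewrite measure_fin_bigcup//.
- by rewrite -fsbig_seq ?index_enum_uniq.
- by move=> i j _ _ [[x c] /=[[_ ic] [_ jc]]]; rewrite -ic -jc.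
- move=> c _; apply: measurableI; first exact: measurable_preimage_fst.
  exact: measurable_label_slice.
Qed.

Lemma integral_label_slice c (k : X -> \bar R) :
  measurable_fun [set: X] k -> (forall x, 0 <= k x) ->
  \int[D]_(z in label_slice c) k z.1 = \int[label_law c]_x k x.
Proof.
move=> mk k0; have mS := measurable_label_slice c.
rewrite ge0_integral_pushforward ?preimage_setT//=.
(* The restricted measure gives mass zero to the complement of the slice and agrees with [D] inside
   it. *)
rewrite [RHS](@ge0_negligible_integral _ _ _ _ _ (~` label_slice c))//.
- rewrite setTD setCK; apply: eq_measure_integral => A mA AS.
  by rewrite /= /mrestr setIidl.
- exact: measurableC.
- by apply: measurableT_comp => //; exact: measurable_fst.
- by rewrite /= /mrestr setICl measure0.
Qed.

(** The entries of [q] are Radon-Nikodym densities of the measures [label_law c], corrected on a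
    null set. Taking [h] nonnegative makes the identity hold in [[0, +oo]] without integrability. *)
Theorem disintegration : exists q : X -> 'rV[R]_n.+1,
  [/\ forall c, measurable_fun [set: X] (fun x => q x 0%R c),
      forall x, simplex (q x) &
      forall h : X * label n -> \bar R,
        (forall c, measurable_fun [set: X] (fun x => h (x, c))) ->
        (forall z, 0 <= h z) ->
        \int[D]_z h z =
        \int[distribution D fst]_x \sum_(c < n.+1) (q x 0%R c)%:E * h (x, c)].
Proof.
pose mu : probability X R := distribution D fst.
pose p c x := Radon_Nikodym_SigmaFinite.f (label_law c) mu x.
have p0 c x : 0 <= p c x.
  exact/Radon_Nikodym_SigmaFinite.f_ge0/label_law_dominated.
have pfin c x : p c x \is a fin_num.
  exact/Radon_Nikodym_SigmaFinite.f_fin_num/label_law_dominated.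
have pint c : mu.-integrable setT (p c).
  exact/Radon_Nikodym_SigmaFinite.f_integrable/label_law_dominated.
have mp c : measurable_fun setT (p c) by exact: measurable_int (pint c).
(* Both sides have the same integral over every measurable set, because the label laws add up to the
   marginal. *)
have p1 : {ae mu, forall x, \sum_(c < n.+1) p c x = 1}.
  have : ae_eq mu setT (fun x => \sum_(c < n.+1) p c x) (cst 1).
    apply: integral_ae_eq => //.
      by apply: integrable_sum => // c _; exact: pint.
    move=> E _ mE; rewrite integral_cst// mul1e ge0_integral_sum//.
    - rewrite -[RHS]sum_label_law//; apply: eq_bigr => c _; apply/esym.
      exact/Radon_Nikodym_SigmaFinite.f_integral/mE/label_law_dominated.
    - by move=> c; exact: measurable_funTS.
  by apply: filterS => x /(_ I).
(* The densities sum to one only almost everywhere; elsewhere [q x] is the vertex of label [0], so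
   that [simplex (q x)] holds at every point. *)
pose good x := (\sum_(c < n.+1) fine (p c x) == 1)%R.
pose q x : 'rV[R]_n.+1 := if good x then \row_c fine (p c x) else delta_mx 0%R 0%R.
have mfp c : measurable_fun setT (fun x => fine (p c x)) by exact: measurableT_comp.
have mgood : measurable_fun setT good.
  by apply: measurable_fun_eqr => //; exact: measurable_sum.
have mq c : measurable_fun setT (fun x => q x 0%R c).
  under eq_fun do rewrite /q (fun_if (fun v : 'rV[R]_n.+1 => v 0%R c)) !mxE.
  exact: measurable_fun_ifT.
exists q; split => //.
- move=> x; rewrite /q; case: ifPn => [/eqP gx|_]; split.
  + by move=> c; rewrite mxE fine_ge0.
  + by under eq_bigr do rewrite mxE.
  + by move=> c; rewrite mxE; case: eqP.
  + by rewrite (bigD1 0%R)//= mxE eqxx big1 ?addr0// => c /negbTE c0; rewrite mxE c0.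
move=> h mh h0.
have mhD : measurable_fun setT h by exact: measurable_fun_label.
(* On the slice of [c] the integrand depends on [x] alone, so its integral passes to [label_law c]
   and then to the density [p c]. *)
transitivity (\sum_(c < n.+1) \int[D]_(z in label_slice c) h (z.1, c)).
  have -> : \int[D]_z h z =
      \int[D]_(z in \big[setU/set0]_(c <- index_enum (label n)) label_slice c) h z.
    congr (integral D _ _); rewrite -bigcup_seq; apply/seteqP; split => // -[x c] _.
    by exists c => //=; rewrite mem_index_enum.
  rewrite ge0_integral_bigsetU ?index_enum_uniq//.
  - by apply: eq_bigr => c _; apply: eq_integral => -[x c'] /[!inE] /= <-.
  - exact: measurable_label_slice.
  - by move=> i j _ _ [[x c] [/= <- <-]].
  - exact: measurable_funTS.
transitivity (\sum_(c < n.+1) \int[mu]_x (h (x, c) * p c x)).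
  apply: eq_bigr => c _; rewrite (integral_label_slice c (k := fun x => h (x, c)))//.
  rewrite Radon_Nikodym_SigmaFinite.change_of_variables//.
  exact: label_law_dominated.
rewrite -ge0_integral_sum//; last 2 first.
- by move=> c; exact: emeasurable_funM.
- by move=> c x _; exact: mule_ge0.
apply: ae_eq_integral => //.
- by apply: emeasurable_sum => c; exact: emeasurable_funM.
- apply: emeasurable_sum => c; apply: emeasurable_funM => //.
  exact/measurable_EFinP.
apply: filterS p1 => x px _; apply: eq_bigr => c _.
rewrite muleC /q ifT ?mxE ?fineK//.
rewrite /good -(inj_eq (@EFin_inj R)) -sumEFin.
by apply/eqP; rewrite -[RHS]px; apply: eq_bigr => i _; rewrite fineK.
Qed.
End conditional_law.

Lemma integral_probability_cst (d : measure_display) (X : measurableType d)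
    (R : realType) (mu : probability X R) (r : R) :
  (\int[mu]_x r%:E = r%:E)%E.
Proof.
by rewrite integral_cst// -[RHS]mule1; congr (_ * _)%E; exact: probability_setT.
Qed.

(** * Jensen's inequality for a convex function with values in [[0, +oo]] *)

Section jensen.
Local Open Scope ereal_scope.
Context (R : realType) (H : R -> \bar R).
Hypothesis H_ge0 : forall e : R, (0 <= e)%R -> 0 <= H e.
Hypothesis H_convex : forall x y t : R, (0 <= x)%R -> (0 <= y)%R ->
  (0 < t < 1)%R -> H (t * x + (1 - t) * y)%R <= t%:E * H x + (1 - t)%R%:E * H y.
Hypothesis H_nondecr : forall x y : R, (0 <= x)%R -> (x <= y)%R -> H x <= H y.

Lemma nondecr_fin_num (x y : R) : (0 <= x)%R -> (x <= y)%R -> H y < +oo ->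
  H x \is a fin_num.
Proof.
move=> x0 xy Hy; rewrite ge0_fin_numE; last exact: H_ge0.
exact: le_lt_trans (H_nondecr x0 xy) Hy.
Qed.

(** Write [a] as a convex combination of [x] and [y] and clear denominators; monotonicity makes all
    three values of [H] finite. *)
Lemma convex_slope_le (x a y : R) : (0 <= x)%R -> (x < a)%R -> (a < y)%R ->
  H y < +oo ->
  ((fine (H a) - fine (H x)) / (a - x) <= (fine (H y) - fine (H a)) / (y - a))%R.
Proof.
move=> x0 xa ay Hy.
have Hyf : H y \is a fin_num by apply: (@nondecr_fin_num y y) => //; lra.
have Haf : H a \is a fin_num by apply: (@nondecr_fin_num a y) => //; lra.
have Hxf : H x \is a fin_num by apply: (@nondecr_fin_num x y) => //; lra.
pose t := ((y - a) / (y - x))%R.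
have yx : (0 < y - x)%R by lra.
have t01 : (0 < t < 1)%R.
  by rewrite divr_gt0 ?ltr_pdivrMr//= ?mul1r; lra.
have at_ : (t * x + (1 - t) * y = a)%R by rewrite /t; field; rewrite gt_eqF.
have y0 : (0 <= y)%R by lra.
have := H_convex x0 y0 t01; rewrite at_.
rewrite -(fineK Hyf) -(fineK Haf) -(fineK Hxf) -!EFinM -EFinD lee_fin.
set A := fine (H a); set B := fine (H x); set C := fine (H y) => h.
have {}h : (A * (y - x) <= (y - a) * B + (a - x) * C)%R.
  rewrite (_ : (y - a) * B + (a - x) * C = (t * B + (1 - t) * C) * (y - x))%R.
    by rewrite ler_pM2r.
  by rewrite /t; field; rewrite gt_eqF.
rewrite ler_pdivrMr; last lra.
rewrite mulrAC ler_pdivlMr /=; last lra.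
nra.
Qed.

(** The slope is the supremum of the slopes of the chords arriving at [a] from the left. The chord
    from [a] to [b] bounds them, hence the need for a finite value beyond [a]. *)
Lemma convex_support_line (a b : R) : (0 < a)%R -> (a < b)%R -> H b < +oo ->
  exists2 s : R, (0 <= s)%R &
    forall e, (0 <= e)%R -> H a + (s * (e - a))%:E <= H e.
Proof.
move=> a0 ab Hb.
have Haf : H a \is a fin_num by apply: (@nondecr_fin_num a b) => //; lra.
pose slope x := ((fine (H a) - fine (H x)) / (a - x))%R.
pose S := [set slope x | x in [set x | 0 <= x < a]]%R.
have ubS y : (a < y)%R -> H y < +oo ->
    ubound S ((fine (H y) - fine (H a)) / (y - a))%R.
  by move=> ay Hy _ [x /= /andP[x0 xa] <-]; exact: convex_slope_le.
have S0 : S (slope 0%R) by exists 0%R => //=; rewrite lexx.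
have supS : has_sup S by split; [exists (slope 0%R)|eexists; exact: ubS ab Hb].
have leS z : S z -> (z <= sup S)%R .
  by apply: ub_le_sup; exact: supS.2.
exists (sup S).
  (* The chord from [0] to [a] already has nonnegative slope, as [H] is non-decreasing. *)
  apply: le_trans (leS _ S0).
  rewrite divr_ge0 ?subr0 ?(ltW a0)// subr_ge0 fine_le//; last first.
    by apply: H_nondecr => //; exact: ltW.
  by apply: (@nondecr_fin_num _ b) => //; lra.
move=> e e0; have [ea|ae|->] := ltgtP e a; last by rewrite subrr mulr0 adde0.
- have Hef : H e \is a fin_num by apply: (@nondecr_fin_num e b) => //; lra.
  rewrite -(fineK Haf) -(fineK Hef) -EFinD lee_fin.
  have : (slope e <= sup S)%R.
    by apply: leS; exists e => //=; rewrite e0.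
  rewrite /slope ler_pdivrMr; last lra.
  nra.
- have [Hey|] := ltP (H e) +oo; last by rewrite leye_eq => /eqP ->; rewrite leey.
  have Hef : H e \is a fin_num by apply: (@nondecr_fin_num e e).
  rewrite -(fineK Haf) -(fineK Hef) -EFinD lee_fin.
  have : (sup S <= (fine (H e) - fine (H a)) / (e - a))%R.
    by apply: ge_sup; [exists (slope 0%R)|exact: ubS].
  rewrite ler_pdivlMr; last lra.
  lra.
Qed.

(* Only [a] is assumed to lie in the domain of [H], so [H] may have no support
   line at [a]; this happens only if [H = +oo] on the right of [a], and then
   [e = a] almost everywhere. *)
Lemma jensen_dominated (d : measure_display) (X : measurableType d)
    (mu : probability X R) (a : R) (e w : X -> R) :
  (0 < a)%R -> H a < +oo -> (forall x, 0 <= e x)%R ->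
  mu.-integrable setT (EFin \o e) -> mu.-integrable setT (EFin \o w) ->
  (forall x, H (e x) <= (w x)%:E) ->
  a%:E <= \int[mu]_x (e x)%:E -> H a <= \int[mu]_x (w x)%:E.
Proof.
move=> a0 Ha e0 ie iw Hew ae.
have Haf : H a \is a fin_num by apply: (@nondecr_fin_num a a) => //; exact: ltW.
have icst (r : R) : mu.-integrable setT (cst r%:E).
  exact: finite_measure_integrable_cst.
have [[b ab Hb]|noH] := pselect (exists2 b, (a < b)%R & H b < +oo).
  have [s s0 hs] := convex_support_line a0 ab Hb.
  (* The integral of this affine minorant is at least [H a], since [0 <= s] and the mean of [e] is
     at least [a]. *)
  have sew x : ((fine (H a) - s * a) + s * e x)%:E <= (w x)%:E.
    apply: le_trans (Hew x); apply: le_trans (hs _ (e0 x)).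
    by rewrite -{2}(fineK Haf) -EFinD lee_fin; lra.
  have ise : mu.-integrable setT (fun x => s%:E * (e x)%:E) by exact: integrableZl.
  apply: (@le_trans _ _ (\int[mu]_x ((fine (H a) - s * a)%:E + s%:E * (e x)%:E))).
    rewrite (integralD measurableT (icst _) ise) (integralZl measurableT ie).
    rewrite [X in _ <= X + _]integral_probability_cst.
    apply: (@le_trans _ _ ((fine (H a) - s * a)%:E + s%:E * a%:E)).
      by rewrite -EFinM -EFinD subrK fineK.
    by rewrite leeD2l// lee_wpmul2l// lee_fin.
  apply: le_integral => //; first exact: (integrableD measurableT (icst _) ise).
  by move=> x _; rewrite -EFinM -EFinD; exact: sew.
have ea x : (e x <= a)%R.
  rewrite leNgt; apply/negP => aex; apply: noH; exists (e x) => //.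
  exact: le_lt_trans (Hew x) (ltry _).
have iae : mu.-integrable setT (fun x => a%:E - (e x)%:E).
  exact: (integrableB _ (icst a) ie).
(* A nonnegative function whose integral is at most [a - a = 0] vanishes almost everywhere. *)
have eae : ae_eq mu setT (fun x => a%:E - (e x)%:E) (cst 0).
  apply/(ae_eq_integral_abs mu measurableT (measurable_int _ iae)).
  under eq_integral => x _.
    rewrite gee0_abs; last by rewrite sube_ge0// lee_fin.
    over.
  apply/eqP; rewrite eq_le integral_ge0 ?andbT; last first.
    by move=> x _; rewrite sube_ge0// lee_fin.
  rewrite (integralB measurableT (icst a) ie).
  by rewrite [X in X - _]integral_probability_cst sube_le0.
rewrite -[H a]fineK// -(integral_probability_cst mu).
have w0 x : 0 <= (w x)%:E by apply: le_trans (Hew x); exact: H_ge0.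
apply: ae_ge0_le_integral => //.
- by move=> x _; rewrite fineK// H_ge0// ltW.
- exact: measurable_int iw.
apply: filterS eae => x /(_ I) /eqP; rewrite -EFinB eqe subr_eq0 => /eqP aex _.
by rewrite fineK// aex.
Qed.
End jensen.

(** * Dense sequences, measurable selection and measurability of the predictor *)

Section score_measurability.
Context (d : measure_display) (X : measurableType d) (R : realType) (n : nat).
Local Notation vec := 'rV[R]_n.+1.

Lemma measurable_ltr_set (g h : X -> R) :
  measurable_fun [set: X] g -> measurable_fun [set: X] h ->
  measurable [set x | g x < h x].
Proof.
move=> mg mh; rewrite -[X in measurable X]setTI.
exact: (measurable_fun_ltr mg mh measurableT (Y := [set true])).
Qed.

Lemma measurable_ler_set (g h : X -> R) :
  measurable_fun [set: X] g -> measurable_fun [set: X] h ->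
  measurable [set x | g x <= h x].
Proof.
move=> mg mh; rewrite -[X in measurable X]setTI.
exact: (measurable_fun_ler mg mh measurableT (Y := [set true])).
Qed.

Lemma measurable_tuple_coordP (f : X -> vec) :
  measurable_fun [set: X] (fun x => [tuple f x 0 i | i < n.+1]) <->
  forall c, measurable_fun [set: X] (fun x => f x 0 c).
Proof.
rewrite measurable_fun_tnthP; split => mf c.
  by have := mf c; apply: eq_measurable_fun => x _ /=; rewrite tnth_mktuple.
by apply: eq_measurable_fun (mf c) => x _ /=; rewrite tnth_mktuple.
Qed.

(** Rational points may lie outside [S], so each rational box that meets [S] contributes one point
    of [S] instead. *)
Lemma countable_dense (S : set vec) : S !=set0 ->
  exists2 s : nat -> vec, (forall i, S (s i)) &
    forall (v : vec) (r : R), S v -> 0 < r -> exists i, forall c, `|v 0 c - s i 0 c| < r.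
Proof.
move=> [v0 Sv0].
(* A box has a rational centre and half-width [1/(2(k+1))], so two of its points differ by less than
   [1/(k+1)] in each coordinate. *)
pose near (q : 'rV[rat]_n.+1 * nat) (v : vec) :=
  forall c, `|v 0 c - ratr (q.1 0 c)| < q.2.+1%:R^-1 / 2.
have /choice[t tP] (q : 'rV[rat]_n.+1 * nat) :
    exists v, S v /\ ((exists2 w, S w & near q w) -> near q v).
  have [[w Sw qw]|noq] := pselect (exists2 w, S w & near q w).
    by exists w.
  by exists v0.
exists (fun i => if unpickle i is Some q then t q else v0).
  by move=> i; case: unpickle => // q; have [] := tP q.
move=> v r Sv r0.
have [k kr] : exists k : nat, k.+1%:R^-1 < r.
  have [k _ kr] := near_infty_natSinv_lt (PosNum r0).
  by exists k; exact: kr (leqnn k).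
have /choice[q qP] c : exists q : rat, `|v 0 c - ratr q| < k.+1%:R^-1 / 2.
  have k0 : 0 < k.+1%:R^-1 / 2 :> R by rewrite divr_gt0 ?invr_gt0.
  have [q] : exists q : rat, ratr q \in `]v 0 c, v 0 c + k.+1%:R^-1 / 2[.
    by apply: rat_in_itvoo; rewrite ltrDl.
  rewrite in_itv/= => /andP[vq qv]; exists q.
  by rewrite distrC gtr0_norm ?subr_gt0// ltrBlDl.
exists (pickle (\row_c q c, k)) => c; rewrite pickleK.
have nv : near (\row_c q c, k) v by move=> i /=; rewrite mxE.
have := (tP (\row_c q c, k)).2 (ex_intro2 _ _ v Sv nv) c; have := nv c.
set u := ratr _ => h1 h2.
rewrite (le_lt_trans _ kr)// [leRHS]splitr (le_trans (ler_distD u _ _))//.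
by rewrite lerD ?ltW// distrC.
Qed.

(** Take the least admissible index: it equals [i] exactly on [A i] minus the earlier sets. *)
Lemma measurable_selection (A : nat -> set X) :
  (forall i, measurable (A i)) -> (forall x, exists i, A i x) ->
  exists2 N : X -> nat, measurable_fun [set: X] N & forall x, A (N x) x.
Proof.
move=> mA exA.
have exA' x : exists i, `[< A i x >] by have [i] := exA x; exists i; exact/asboolP.
exists (fun x => ex_minn (exA' x)); last first.
  by move=> x; case: ex_minnP => i /asboolP.
move=> _ B _; rewrite setTI.
rewrite [X in measurable X](_ : _ = \bigcup_(i in B)
    (A i `\` \bigcup_(j in `I_i) A j)).
  apply: bigcup_measurable => i _; apply: measurableD => //.
  exact: bigcup_measurable.
apply/seteqP; split => x /=.
  case: ex_minnP => i /asboolP Aix imin Bi; exists i => //; split => //.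
  by move=> [j /= ji Ajx]; have := imin j (asboolT Ajx); rewrite leqNgt ji.
move=> [i Bi [Aix Nj]]; case: ex_minnP => j /asboolP Ajx jmin.
suff -> : j = i by [].
apply/eqP; rewrite eqn_leq jmin ?asboolT//= leqNgt; apply/negP => ji.
by apply: Nj; exists j.
Qed.

Lemma continuous_coord (u : vec -> R) : continuous u ->
  forall (v : vec) (e : R), 0 < e ->
  exists2 r : R, 0 < r &
    forall w : vec, (forall c, `|v 0 c - w 0 c| < r) -> `|u v - u w| < e.
Proof.
move=> cu v e e0.
have /cvgrPdist_lt /(_ e e0) /nbhs_ballP[r /= r0 ru] := cu v.
exists r => // w vw; apply: ru; split => // i j.
by rewrite ord1; exact: vw.
Qed.

(* [u \o f] is a pointwise limit of [u \o s \o N k], where [s] is dense and [N k]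
   selects a point of [s] within [1/(k+1)] of [f]. *)
Lemma measurable_continuous_comp (u : vec -> R) (f : X -> vec) :
  continuous u -> (forall c, measurable_fun [set: X] (fun x => f x 0 c)) ->
  measurable_fun [set: X] (u \o f).
Proof.
move=> cu mf.
have [s _ sP] := @countable_dense setT (ex_intro _ 0 I).
have /choice[N NP] (k : nat) : exists N : X -> nat, measurable_fun [set: X] N /\
    forall x c, `|f x 0 c - s (N x) 0 c| < k.+1%:R^-1.
  pose A i := \bigcap_(c in [set: 'I_n.+1])
    [set x | `|f x 0 c - s i 0 c| < k.+1%:R^-1].
  have [| |N mN AN] := @measurable_selection A.
  - move=> i; apply: fin_bigcap_measurable => [|c _]; first exact: finite_finset.
    apply: measurable_ltr_set => //.
    by apply: measurableT_comp => //; exact: measurable_funB.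
  - move=> x; have k0 : 0 < k.+1%:R^-1 :> R by rewrite invr_gt0.
    by have [i ix] := sP (f x) _ I k0; exists i => c _; exact: ix.
  by exists N; split => // x c; exact: (AN x c).
apply: (@measurable_fun_cvg _ _ _ _ (fun k x => u (s (N k x)))).
- by move=> k _ Y mY; exact: ((NP k).1 measurableT ((u \o s) @^-1` Y)).
move=> x _; apply/cvgrPdist_lt => e e0.
have [r r0 ru] := continuous_coord cu (f x) e0.
have [k0 _ k0r] := near_infty_natSinv_lt (PosNum r0).
exists k0 => // k k0k; apply: ru => c.
exact: lt_trans ((NP k).2 x c) (k0r _ k0k).
Qed.

(** The prediction depends only on the finite table of comparisons between scores, and each
    comparison is a measurable condition on [x]. *)
Lemma measurable_pred_score (f : X -> vec) :
  (forall c, measurable_fun [set: X] (fun x => f x 0 c)) ->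
  measurable_fun [set: X] (fun x => pred_score (f x)).
Proof.
move=> mf _ B _; rewrite setTI.
(* [G] reads the prediction off a comparison table; a tie is expressed by two opposite
   inequalities. *)
pose G (b : {ffun 'I_n.+1 * 'I_n.+1 -> bool}) : label n :=
  odflt ord0 [pick c : 'I_n.+1 | [forall c', b (c', c)] &&
    [forall c' : 'I_n.+1, b (c', c) && b (c, c') ==> (c <= c')%N]].
pose bf x := [ffun ij : 'I_n.+1 * 'I_n.+1 => f x 0 ij.1 <= f x 0 ij.2].
have predE x : pred_score (f x) = G (bf x).
  rewrite /pred_score /G; congr odflt; apply: eq_pick => c; congr andb.
    by apply: eq_forallb => c'; rewrite ffunE.
  by apply: eq_forallb => c'; rewrite !ffunE /= eq_le.
rewrite [X in measurable X](_ : _ = \bigcup_(b in [set b | B (G b)])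
    \bigcap_(ij in [set: 'I_n.+1 * 'I_n.+1])
      [set x | (f x 0 ij.1 <= f x 0 ij.2) = b ij]).
  apply: fin_bigcup_measurable => [|b _]; first exact: finite_finset.
  apply: fin_bigcap_measurable => [|ij _]; first exact: finite_finset.
  rewrite -[X in measurable X]setTI.
  exact: (@measurable_fun_ler _ _ _ _ _ _ (mf ij.1) (mf ij.2) measurableT [set b ij]).
apply/seteqP; split => x /=.
  by rewrite predE => BG; exists (bf x) => // ij _ /=; rewrite ffunE.
move=> [b /= BG bx]; rewrite predE (_ : bf x = b)//.
by apply/ffunP => ij; rewrite ffunE; exact: bx.
Qed.

End score_measurability.

(** * Measurable minimizers of the conditional risks *)

Section near_minimizers.
Context (d : measure_display) (X : measurableType d) (R : realType) (n : nat).
Local Notation vec := 'rV[R]_n.+1.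

Lemma simplex_sum_ge (q u : 'I_n.+1 -> R) (M : R) :
  (forall c, 0 <= q c) -> \sum_c q c = 1 -> (forall c, M <= u c) ->
  M <= \sum_c q c * u c.
Proof.
move=> q0 q1 Mu; rewrite -[M]mul1r -q1 mulr_suml.
by apply: ler_sum => c _; exact: ler_wpM2l.
Qed.

Lemma continuous_cond_srisk (Phi : vec -> label n -> R) (q : vec) :
  (forall c, continuous (Phi ^~ c)) -> continuous (fun v => cond_srisk Phi v q).
Proof.
move=> Phi_cont; apply: continuous_big => [|c _]; first exact: add_continuous.
by move=> v; apply: continuousM; [exact: cst_continuous|exact: Phi_cont].
Qed.

Lemma measurable_cond_srisk (Phi : vec -> label n -> R) (f q : X -> vec) :
  (forall c, continuous (Phi ^~ c)) ->
  (forall c, measurable_fun [set: X] (fun x => f x 0 c)) ->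
  (forall c, measurable_fun [set: X] (fun x => q x 0 c)) ->
  measurable_fun [set: X] (fun x => cond_srisk Phi (f x) (q x)).
Proof.
move=> Phi_cont mf mq; apply: measurable_sum => c; apply: measurable_funM => //.
exact: (measurable_continuous_comp (Phi_cont c)).
Qed.

Lemma measurable_cond_risk (L : 'M[R]_n.+1) (f q : X -> vec) :
  (forall c, measurable_fun [set: X] (fun x => f x 0 c)) ->
  (forall c, measurable_fun [set: X] (fun x => q x 0 c)) ->
  measurable_fun [set: X] (fun x => cond_risk L (f x) (q x)).
Proof.
move=> mf mq; apply: measurable_sum => c; apply: measurable_funM => //.
move=> _ Y _; rewrite setTI.
have := measurable_pred_score mf measurableT (Y := (L ^~ c) @^-1` Y) I.
by rewrite setTI.
Qed.

(** Comparing [s i] only with the members of the sequence keeps the set of good [x] a countable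
    intersection, so an index can be selected measurably. *)
Lemma near_minimizer_sequence (S : set vec) (s : nat -> vec) (u : vec -> X -> R)
    (e : R) :
  (forall i, S (s i)) -> (forall i, measurable_fun [set: X] (u (s i))) ->
  (forall x, exists i, forall j, u (s i) x <= u (s j) x + e) ->
  exists2 g : X -> vec, score_funs S g & forall x j, u (g x) x <= u (s j) x + e.
Proof.
move=> Ss mu exu.
pose A i := \bigcap_j [set x | u (s i) x <= u (s j) x + e].
have [| |N mN AN] := @measurable_selection _ _ A.
- move=> i; apply: bigcapT_measurable => j; apply: measurable_ler_set => //.
  exact: measurable_funD.
- by move=> x; have [i ix] := exu x; exists i => j _; exact: ix.
exists (s \o N); last by move=> x j; exact: (AN x j I).
split => [x|]; first exact: Ss.
apply/measurable_tuple_coordP => c _ Y _.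
exact: (mN measurableT ((fun i => s i 0 c) @^-1` Y)).
Qed.

(** Half of [e] pays for an infimum along a dense sequence that may not be attained, the other half
    for passing from the sequence to all of [S] by continuity. *)
Lemma surrogate_near_minimizer (Phi : vec -> label n -> R) (M : R)
    (S : set vec) (q : X -> vec) (e : R) :
  (forall c, continuous (Phi ^~ c)) -> (forall v c, M <= Phi v c) ->
  S !=set0 -> (forall c, measurable_fun [set: X] (fun x => q x 0 c)) ->
  (forall x, simplex (q x)) -> 0 < e ->
  exists2 g : X -> vec, score_funs S g & forall x v, S v ->
    cond_srisk Phi (g x) (q x) <= cond_srisk Phi v (q x) + e.
Proof.
move=> Phi_cont PhiM S0 mq sq e0.
have e20 : 0 < e / 2 by rewrite divr_gt0.
have [s Ss dense] := countable_dense S0.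
have [//| | |g gS gmin] :=
  @near_minimizer_sequence S s (fun v x => cond_srisk Phi v (q x)) (e / 2).
- by move=> i; exact: measurable_cond_srisk.
- move=> x; pose V := range (fun i => cond_srisk Phi (s i) (q x)).
  have infV : has_inf V.
    split; first by exists (cond_srisk Phi (s 0%N) (q x)); exists 0%N.
    exists M => _ [i _ <-]; apply: simplex_sum_ge => //; first exact: (sq x).1.
    exact: (sq x).2.
  have [_ [i _ <-] Vi] := inf_adherent e20 infV.
  exists i => j; apply: (le_trans (ltW Vi)); rewrite lerD2r.
  by apply: ge_inf; [exact: infV.2|exists j].
exists g => // x v Sv.
have [r r0 vr] := continuous_coord (continuous_cond_srisk (q := q x) Phi_cont) v e20.
have [j vj] := dense _ _ Sv r0.
have := vr _ vj; have := gmin x j; rewrite ltr_distl => h /andP[h1 h2].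
by lra.
Qed.

(** At fixed [x] the conditional task risk depends only on the predicted label, so one
    representative per attainable label suffices and the minimum is exact. *)
Lemma task_minimizer (L : 'M[R]_n.+1) (S : set vec) (q : X -> vec) :
  S !=set0 -> (forall c, measurable_fun [set: X] (fun x => q x 0 c)) ->
  exists2 h : X -> vec, score_funs S h & forall x v, S v ->
    cond_risk L (h x) (q x) <= cond_risk L v (q x).
Proof.
move=> [v0 Sv0] mq.
(* [t c] predicts [c] whenever some point of [S] does; otherwise it is merely a point of [S]. *)
have /choice[t tP] (c : 'I_n.+1) : exists v, S v /\
    ((exists2 w, S w & pred_score w = c) -> pred_score v = c).
  have [[w Sw wc]|noc] := pselect (exists2 w, S w & pred_score w = c).
    by exists w.
  by exists v0.
have [| | |h hS hmin] := @near_minimizer_sequence S (fun i => t (inord i))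
  (fun v x => cond_risk L v (q x)) 0.
- by move=> i; exact: (tP _).1.
- by move=> i; exact: measurable_cond_risk.
- move=> x.
  case: (@arg_minP _ _ _ ord0 predT (fun c => cond_risk L (t c) (q x)) isT) => c _ cmin.
  by exists c => j; rewrite addr0 inord_val; exact: cmin.
exists h => // x v Sv; have := hmin x (pred_score v).
rewrite addr0 inord_val => /le_trans; apply.
by rewrite /cond_risk (tP (pred_score v)).2//; exists v.
Qed.
End near_minimizers.

(** * Risks as integrals of conditional risks *)

(** The integral may be [+oo], so additivity for integrable functions does not apply; the negative
    part is bounded by [|M|] and can be subtracted safely. *)
Lemma integral_shift (d : measure_display) (X : measurableType d) (R : realType)
    (mu : probability X R) (k : X -> R) (M : R) :
  measurable_fun setT k -> (forall x, M <= k x) ->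
  (\int[mu]_x (k x)%:E = \int[mu]_x (k x - M)%:E + M%:E)%E.
Proof.
move=> mk Mk; rewrite integralE.
set A := (\int[mu]_x _ x)%E; set B := (\int[mu]_x _ x)%E; set C := (\int[mu]_x _)%E.
have MM : 0 <= `|M| + M by rewrite -lerBlDr sub0r -normrN ler_norm.
have mkE : measurable_fun setT (EFin \o k) by exact/measurable_EFinP.
have C0 : (0 <= C)%E by apply: integral_ge0 => x _; rewrite lee_fin subr_ge0.
have A0 : (0 <= A)%E by apply: integral_ge0 => x _.
have Bfin : B \is a fin_num.
  have B0 : (0 <= B)%E by apply: integral_ge0 => x _.
  rewrite ge0_fin_numE//; apply: le_lt_trans (ltry `|M|).
  rewrite -(integral_probability_cst mu).
  apply: ge0_le_integral => //; first exact: measurable_funeneg.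
  move=> x _; rewrite funenegE ge_max; apply/andP; split; rewrite lee_fin//.
  by rewrite lerNl (le_trans _ (Mk x))// lerNl -normrN ler_norm.
(* Integral of [k^+ + |M| = (k - M) + (k^- + (|M| + M))], where every term is nonnegative. *)
have : (A + `|M|%:E = C + (B + (`|M| + M)%:E))%E.
  rewrite -[in LHS](integral_probability_cst mu)
    -[X in (_ + (_ + X))%E](integral_probability_cst mu).
  rewrite -!ge0_integralD//.
  - apply: eq_integral => x _; rewrite funeposE funenegE /= -!EFin_max -!EFinD.
    by congr EFin; rewrite /Num.max; do 2 case: ifPn; rewrite -?leNgt; lra.
  - by move=> x _; rewrite lee_fin subr_ge0.
  - by apply/measurable_EFinP; exact: measurable_funB.
  - by move=> x _; rewrite adde_ge0.
  - by apply: emeasurable_funD => //; exact: measurable_funeneg.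
  - exact: measurable_funeneg.
  - exact: measurable_funepos.
rewrite -(fineK Bfin).
case: (A) A0 => [a| |]// _; case: (C) C0 => [c| |]// _.
by rewrite -!EFinD => -[h]; congr EFin; lra.
Qed.

Section risks_as_integrals.
Local Open Scope ereal_scope.
Context (d : measure_display) (X : measurableType d) (R : realType) (n : nat).
Local Notation vec := 'rV[R]_n.+1.
Variables (D : probability (X * label n)%type R) (q : X -> vec).
Let mu : probability X R := distribution D fst.
Hypothesis mq : forall c, measurable_fun [set: X] (fun x => q x 0%R c).
Hypothesis sq : forall x, simplex (q x).
Hypothesis Dq : forall h : X * label n -> \bar R,
  (forall c, measurable_fun [set: X] (fun x => h (x, c))) ->
  (forall z, 0 <= h z) ->
  \int[D]_z h z = \int[mu]_x \sum_(c < n.+1) (q x 0%R c)%:E * h (x, c).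

Lemma task_riskE (L : 'M[R]_n.+1) (S : set vec) (g : X -> vec) :
  (forall i j, 0 <= L i j)%R -> score_funs S g ->
  task_risk D L g = \int[mu]_x (cond_risk L (g x) (q x))%:E.
Proof.
move=> L0 [_ /measurable_tuple_coordP mg]; rewrite /task_risk Dq.
- apply: eq_integral => x _; rewrite /cond_risk -sumEFin.
  by apply: eq_bigr => c _; rewrite EFinM.
- move=> c; apply/measurable_EFinP => _ Y _.
  exact: (measurable_pred_score mg measurableT (Y := (L ^~ c) @^-1` Y)).
- by move=> z; rewrite lee_fin.
Qed.

(** [Dq] is for nonnegative integrands, hence the shift by [M]; the constant passes through the
    conditional average because the entries of [q x] sum to one. *)
Lemma surrogate_riskE (Phi : vec -> label n -> R) (M : R) (S : set vec)
    (g : X -> vec) :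
  (forall c, continuous (Phi ^~ c)) -> (forall v c, M <= Phi v c)%R ->
  score_funs S g ->
  surrogate_risk D Phi g =
  \int[mu]_x (cond_srisk Phi (g x) (q x) - M)%:E + M%:E.
Proof.
move=> Phi_cont PhiM [_ /measurable_tuple_coordP mg].
have mPhi c : measurable_fun [set: X] (fun x => Phi (g x) c).
  exact: (measurable_continuous_comp (Phi_cont c)).
rewrite /surrogate_risk (@integral_shift _ _ _ _ _ M)//; last first.
  exact: measurable_fun_label.
congr (_ + _); rewrite Dq.
- apply: eq_integral => x _; rewrite /cond_srisk.
  rewrite -{2}[M]mul1r -(sq x).2 mulr_suml -sumrB -sumEFin.
  by apply: eq_bigr => c _; rewrite -EFinM mulrBr.
- move=> c; apply/measurable_EFinP.
  exact: (measurable_funB (mPhi c) (measurable_cst M)).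
- by move=> z; rewrite lee_fin subr_ge0.
Qed.
End risks_as_integrals.

(** * The calibration bound *)

(** A crude bound, uniform in [v] and [q], that makes every conditional task risk integrable. *)
Lemma cond_risk_bound (R : realType) (n : nat) (L : 'M[R]_n.+1)
    (v q : 'rV[R]_n.+1) :
  (forall i j, 0 <= L i j) -> simplex q ->
  0 <= cond_risk L v q <= \sum_i \sum_j L i j.
Proof.
move=> L0 [q0 q1]; apply/andP; split.
  by apply: sumr_ge0 => c _; exact: mulr_ge0.
rewrite /cond_risk; apply: (@le_trans _ _ (\sum_j L (pred_score v) j)).
  apply: ler_sum => c _; rewrite ler_piMl// -q1 (bigD1 c)//= lerDl.
  by apply: sumr_ge0.
rewrite [leRHS](bigD1 (pred_score v))//= lerDl.
by apply: sumr_ge0 => i _; exact: sumr_ge0.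
Qed.

Theorem theorem2 (d : measure_display) (X : measurableType d)
  (R : realType) (n : nat)
  (L : 'M[R]_n.+1) (L_ge0 : forall i j, 0 <= L i j)
  (Phi : 'rV[R]_n.+1 -> label n -> R)
  (Phi_cont : forall c : label n, continuous (fun v : 'rV[R]_n.+1 => Phi v c))
  (Phi_lb : exists M : R, forall v c, M <= Phi v c)
  (F : {vspace 'rV[R]_n.+1})
  (Hc : R -> \bar R)
  (Hc_ge0 : forall e : R, 0 <= e -> (0 <= Hc e)%E)
  (Hc_convex : forall x y t : R, 0 <= x -> 0 <= y -> 0 < t < 1 ->
     (Hc (t * x + (1 - t) * y)%R <= t%:E * Hc x + (1 - t)%R%:E * Hc y)%E)
  (Hc_nondecr : forall x y : R, 0 <= x -> x <= y -> (Hc x <= Hc y)%E)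
  (Hc_le : forall e : R, 0 <= e ->
     (Hc e <= calibration Phi L [set v | v \in F] e)%E)
  (D : probability (X * label n)%type R)
  (eps : R) (eps_gt0 : 0 < eps) (Hc_fin : Hc eps \is a fin_num)
  (f : X -> 'rV[R]_n.+1) (f_in : score_funs [set v | v \in F] f) :
  (surrogate_risk D Phi f <
     ereal_inf [set surrogate_risk D Phi g | g in score_funs [set v | v \in F]]
     + Hc eps)%E ->
  (task_risk D L f <
     ereal_inf [set task_risk D L g | g in score_funs [set v | v \in F]]
     + eps%:E)%E.
Proof.
set S := [set v | v \in F].
case: Phi_lb => M PhiM.
have S0 : S !=set0 by exists 0; exact: mem0v.
have [q [mq sq Dq]] := disintegration D.
pose mu : probability X R := distribution D fst.
have taskE g : score_funs S g -> task_risk D L g = _ := task_riskE Dq L_ge0.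
have surE g : score_funs S g -> surrogate_risk D Phi g = _ :=
  surrogate_riskE sq Dq Phi_cont PhiM.
have [h hS hmin] := task_minimizer L S0 mq.
set Rphi := ereal_inf _; move=> Rf.
rewrite ltNge; apply/negP => contra.
have mcoord g : score_funs S g ->
    forall c, measurable_fun [set: X] (fun x => g x 0 c).
  by move=> [_ /measurable_tuple_coordP].
have icst (r : R) : mu.-integrable setT (EFin \o cst r).
  exact: finite_measure_integrable_cst.
have icond g : score_funs S g ->
    mu.-integrable setT (fun x => (cond_risk L (g x) (q x))%:E).
  move=> gS; apply: (le_integrable measurableT _ _ (icst (\sum_i \sum_j L i j))) => //.
    by apply/measurable_EFinP; exact/measurable_cond_risk/mq/mcoord.
  move=> x _; have /andP[l0 lL] := cond_risk_bound (g x) L_ge0 (sq x).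
  by rewrite /= lee_fin !ger0_norm// (le_trans l0).
pose e x := cond_risk L (f x) (q x) - cond_risk L (h x) (q x).
have e0 x : 0 <= e x by rewrite subr_ge0; apply: hmin; exact: f_in.1.
have ie : mu.-integrable setT (EFin \o e).
  exact: (integrableB measurableT (icond _ f_in) (icond _ hS)).
(* The pointwise minimizer [h] has the least task risk among score functions, so [contra] bounds the
   difference of the risks of [f] and [h] from below. *)
have epse : (eps%:E <= \int[mu]_x (e x)%:E)%E.
  have -> : (\int[mu]_x (e x)%:E = task_risk D L f - task_risk D L h)%E.
    rewrite (taskE _ f_in) (taskE _ hS).
    exact: (integralB measurableT (icond _ f_in) (icond _ hS)).
  have hfin : task_risk D L h \is a fin_num.
    by rewrite (taskE _ hS); exact: (integrable_fin_num measurableT (icond _ hS)).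
  rewrite leeBrDr// addeC; apply: le_trans contra; rewrite leeD2r//.
  apply/ereal_infP => _ [g gS <-]; rewrite (taskE _ hS) (taskE _ gS).
  apply: (le_integral measurableT (icond _ hS) (icond _ gS)) => x _.
  by rewrite lee_fin; apply: hmin; exact: gS.1.
have Rphile g : score_funs S g -> (Rphi <= surrogate_risk D Phi g)%E.
  by move=> gS; apply: ereal_inf_lbound; exists g.
(* Either infinite value of [Rphi] contradicts the strict inequality [Rf]. *)
have Rphifin : Rphi \is a fin_num.
  rewrite fin_numE; apply/andP; split; apply/eqP => Rphioo.
    by move: Rf; rewrite Rphioo addNye// ltNge leNye.
  have := lt_le_trans Rf (leey _); have := Rphile _ f_in.
  by rewrite Rphioo leye_eq => /eqP ->.
(* The excess is over the constant [M], not over the conditional infimum. *)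
pose excess g x := cond_srisk Phi (g x) (q x) - M.
have excess0 g x : 0 <= excess g x.
  by rewrite subr_ge0; apply: simplex_sum_ge => //; [exact: (sq x).1|exact: (sq x).2].
have mexcess g : score_funs S g -> measurable_fun setT (excess g).
  move=> gS; apply: measurable_funB => //.
  exact: (measurable_cond_srisk Phi_cont (mcoord _ gS) mq).
have iexcess g : score_funs S g -> (\int[mu]_x (excess g x)%:E < +oo)%E ->
    mu.-integrable setT (EFin \o excess g).
  move=> gS goo; apply/integrableP; split.
    by apply/measurable_EFinP; exact: mexcess.
  by under eq_integral do rewrite /= ger0_norm//.
have foo : (\int[mu]_x (excess f x)%:E < +oo)%E.
  have := lt_le_trans Rf (leey _); rewrite (surE _ f_in).
  by case: (\int[mu]_x _)%E => // r _; exact: ltry.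
have ifx := iexcess _ f_in foo.
pose If := fine (\int[mu]_x (excess f x)%:E).
have IfE : (\int[mu]_x (excess f x)%:E = If%:E)%E.
  by rewrite fineK//; exact: (integrable_fin_num measurableT ifx).
pose gap := fine Rphi + fine (Hc eps) - (If + M).
have gap0 : 0 < gap.
  move: Rf; rewrite (surE _ f_in) IfE -(fineK Rphifin) -(fineK Hc_fin).
  by rewrite -!EFinD lte_fin /gap subr_gt0.
have gap20 : 0 < gap / 2 by rewrite divr_gt0.
have [g gS gmin] := surrogate_near_minimizer Phi_cont PhiM S0 mq sq gap20.
have gf x : excess g x <= excess f x + gap / 2.
  by have := gmin x _ (f_in.1 x); rewrite /excess; lra.
have ifg : mu.-integrable setT (fun x => (excess f x)%:E + (gap / 2)%:E)%E.
  exact: (integrableD measurableT ifx (icst _)).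
have igx : mu.-integrable setT (EFin \o excess g).
  apply: (le_integrable measurableT _ _ ifg) => //.
    by apply/measurable_EFinP; exact: mexcess.
  by move=> x _; rewrite /= lee_fin !ger0_norm// (le_trans _ (gf x)).
pose Ig := fine (\int[mu]_x (excess g x)%:E).
have IgE : (\int[mu]_x (excess g x)%:E = Ig%:E)%E.
  by rewrite fineK//; exact: (integrable_fin_num measurableT igx).
(* An integrable upper bound for the excess conditional surrogate risk of [f]: the value at [g x]
   minus [gap / 2] stands in for the infimum over [S]. *)
pose w x := excess f x + gap / 2 - excess g x.
have iw : mu.-integrable setT (EFin \o w) by exact: (integrableB measurableT ifg igx).
have intw : (\int[mu]_x (w x)%:E = (If + gap / 2 - Ig)%:E)%E.
  have -> : (\int[mu]_x (w x)%:E =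
      \int[mu]_x ((excess f x)%:E + (gap / 2)%:E) -
      \int[mu]_x (excess g x)%:E)%E.
    exact: (integralB measurableT ifg igx).
  rewrite (integralD measurableT ifx (icst _)).
  by rewrite IfE IgE [X in (_ + X - _)%E]integral_probability_cst.
have Hew x : (Hc (e x) <= (w x)%:E)%E.
  apply: le_trans (Hc_le _ (e0 x)) _.
  have fx := f_in.1 x.
  apply: (@le_trans _ _ (excess_cond_srisk Phi S (f x) (q x))).
    (* The pair [(f x, q x)] is feasible at level [e x], since the infimum over [S] is at most the
       value at [h x]. *)
    apply: ereal_inf_lbound; exists (f x), (q x); split => //.
    rewrite /e EFinB leeB//; apply: ereal_inf_lbound.
    by exists (h x) => //; exact: hS.1.
  rewrite /excess_cond_srisk.
  have -> : w x = cond_srisk Phi (f x) (q x) - (cond_srisk Phi (g x) (q x) - gap / 2).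
    by rewrite /w /excess; lra.
  rewrite EFinB leeB//; apply/ereal_infP => _ [v Sv <-].
  by rewrite lee_fin lerBlDr; exact: gmin.
have Hcoo : (Hc eps < +oo)%E by rewrite ltey_eq Hc_fin.
(* Jensen gives [Hc eps <= If + gap / 2 - Ig]; with [Rphi <= Ig + M] this yields [gap <= gap / 2],
   against [0 < gap]. *)
have := jensen_dominated Hc_ge0 Hc_convex Hc_nondecr eps_gt0 Hcoo e0 ie iw Hew epse.
have := Rphile _ gS; rewrite (surE _ gS) IgE intw.
rewrite -(fineK Rphifin) -(fineK Hc_fin) -!EFinD !lee_fin.
by move: gap0; rewrite /gap; lra.
Qed.
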